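(* Let $n\ge3$ and $r\ge2$. The vector space of homogeneous monogenic spinors of degree $r$ for the $2$-Dirac operator on $M(n,2,\mathbb R)$ is naturally isomorphic to the direct sum of the vector spaces of homogeneous spinors of degree $r$ and of degree $r-1$ in the variables $t_1,t_2,\dots,t_{2n-3}$, where $(t_1,\dots,t_{2n})$ are the linear coordinates on $M(n,2,\mathbb R)$ in which the matrix $(x_{\alpha i})$ is given by $x_{\alpha1}=t_{2\alpha-1},\ x_{\alpha2}=t_{2\alpha}$ for $1\le\alpha\le n-3$; $x_{n-2,1}=t_{2n-5},\ x_{n-2,2}=t_{2n-1}$; $x_{n-1,1}=t_{2n},\ x_{n-1,2}=t_{2n-4}$; $x_{n,1}=t_{2n-3}+t_{2n-2},\ x_{n,2}=t_{2n-3}-t_{2n-2}$.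
   Context: $\varepsilon_1,\dots,\varepsilon_n$ is an orthonormal basis of Euclidean $\mathbb R^n$, with Clifford relations $\varepsilon_\alpha\varepsilon_\beta+\varepsilon_\beta\varepsilon_\alpha=-2\delta_{\alpha\beta}$. $\mathbb S$ is the complex spinor module of $\mathfrak{so}(n)$: the unique spinor module if $n$ is odd, and the direct sum $\mathbb S_+\oplus\mathbb S_-$ of the two non-isomorphic spinor modules if $n$ is even; $\mathbb R^n$ acts on it by Clifford multiplication. $M(n,2,\mathbb R)$ is the space of real $n\times2$ matrices with coordinates $x_{\alpha i}$, $1\le\alpha\le n$, $i=1,2$. The $2$-Dirac operator is $\partial=(\partial_1,\partial_2)$, $\partial_i\psi=\sum_{\alpha=1}^n\varepsilon_\alpha\cdot\frac{\partial\psi}{\partial x_{\alpha i}}$, on $\mathbb S$-valued functions. A monogenic spinor is a solution of $\partial\psi=0$. A spinor here means an $\mathbb S$-valued function; it is homogeneous of degree $r$ if its components are homogeneous polynomials of degree $r$. *)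

(* Defs.v *)
From HB Require Import structures.
From mathcomp Require Import all_boot all_order all_algebra.
From mathcomp Require Import reals.
From mathcomp.real_closed Require Import complex.
From mathcomp Require Import mpoly.

Set Implicit Arguments.
Unset Strict Implicit.
Unset Printing Implicit Defensive.

Import Order.TTheory GRing.Theory Num.Theory.

Local Open Scope ring_scope.

(* The reals are a realType R and the complex numbers R[i]. *)

Section SpinorModule.
Variables (R : realType) (n N : nat).

(* The module is C^N, and eps a is the matrix of the Clifford multiplication
   by the a-th vector of an orthonormal basis of R^n (indexed from 0). *)
Variable eps : 'I_n -> 'M[R[i]]_N.

Definition clifford_relations :=
  forall a b, eps a *m eps b + eps b *m eps a = (- (2 *+ (a == b)))%:M.

(* The action of so(n) = { X | X^T = - X }.  The factor -1/4 is the one for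
   which the commutator of so_action X with eps b is the Clifford
   multiplication by the b-th column of X. *)
Definition so_action (X : 'M[R]_n) : 'M[R[i]]_N :=
  - 4^-1 *: \sum_a \sum_b (X a b)%:C%C *: (eps a *m eps b).

Definition so_stable (U : {vspace 'cV[R[i]]_N}) :=
  forall X : 'M[R]_n, X^T = - X ->
  forall v, v \in U -> so_action X *m v \in U.

Definition so_irreducible (U : {vspace 'cV[R[i]]_N}) :=
  [/\ so_stable U, U <> 0%VS &
      forall W, (W <= U)%VS -> so_stable W -> W = 0%VS \/ W = U].

Definition so_isomorphic (U V : {vspace 'cV[R[i]]_N}) :=
  exists f : 'End('cV[R[i]]_N),
    [/\ (lker f :&: U = 0)%VS, (f @: U = V)%VS &
        forall X : 'M[R]_n, X^T = - X ->
        forall v, v \in U -> f (so_action X *m v) = so_action X *m f v].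

(* For n odd, the two irreducible Clifford modules (they differ by eps -> -eps)
   restrict to the same spinor module of so(n); both are allowed. *)
Definition spinor_module :=
  clifford_relations /\
  if odd n then so_irreducible fullv
  else exists Sp Sm : {vspace 'cV[R[i]]_N},
    [/\ so_irreducible Sp, so_irreducible Sm, ~ so_isomorphic Sp Sm,
        (Sp + Sm = fullv)%VS & (Sp :&: Sm = 0)%VS].

End SpinorModule.

(* C^N-valued polynomial functions of m real variables, by components. *)
Notation spinor R m N := {ffun 'I_N -> {mpoly R[i][m]}}.

Section Spinors.
Variables (R : realType) (N : nat).

Definition homogeneous m (r : nat) (psi : spinor R m N) :=
  forall s, psi s \is r.-homog.

Section Dirac.
Variables (n : nat) (eps : 'I_n -> 'M[R[i]]_N).

(* Polynomials on M(n,2,R) are written in n * 2 variables: the coordinate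
   x_(a,i) is the variable of index mxvec_index a i. *)
Definition dirac (i : 'I_2) (psi : spinor R (n * 2) N) : spinor R (n * 2) N :=
  [ffun s => \sum_a \sum_s' eps a s s' *: (psi s')^`M(mxvec_index a i)].

Definition monogenic (psi : spinor R (n * 2) N) := forall i, dirac i psi = 0.

End Dirac.

(* The variable t_k among t_1, ..., t_m (indexed from 1); it is 0 for k > m. *)
Definition tvar m (k : nat) : {mpoly R[i][m]} := \sum_(j < m | j.+1 == k) 'X_j.

Definition dt m (k : nat) (psi : spinor R m N) : spinor R m N :=
  [ffun s => \sum_(j < m | j.+1 == k) (psi s)^`M(j)].

(* The matrix (x_(a,i)) in terms of the coordinates t_1, ..., t_(2n). *)
Definition xcoord n : 'M[{mpoly R[i][2 * n]}]_(n, 2) :=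
  let t := tvar (2 * n) in
  \matrix_(a < n, i < 2)
    let al := a.+1 in
    if (al <= n - 3)%N then
      if i == 0 then t (2 * al - 1)%N else t (2 * al)%N
    else if al == (n - 2)%N then
      if i == 0 then t (2 * n - 5)%N else t (2 * n - 1)%N
    else if al == (n - 1)%N then
      if i == 0 then t (2 * n)%N else t (2 * n - 4)%N
    else
      if i == 0 then t (2 * n - 3)%N + t (2 * n - 2)%N
      else t (2 * n - 3)%N - t (2 * n - 2)%N.

Definition to_tcoord n (psi : spinor R (n * 2) N) : spinor R (2 * n) N :=
  [ffun s => psi s \mPo [tuple mxvec (xcoord n) 0 k | k < n * 2]].

(* Restriction to t_(l+1) = ... = t_m = 0. *)
Definition trestrict m l (psi : spinor R m N) : spinor R l N :=
  [ffun s => psi s \mPo [tuple tvar l k.+1 | k < m]].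

(* The values of psi and of its derivative along t_(2n-2) on the subspace
   t_(2n-2) = t_(2n-1) = t_(2n) = 0. *)
Definition initial_data n (psi : spinor R (n * 2) N) :
    spinor R (2 * n - 3) N * spinor R (2 * n - 3) N :=
  (trestrict (2 * n - 3) (to_tcoord psi),
   trestrict (2 * n - 3) (dt (2 * n - 2) (to_tcoord psi))).

End Spinors.

(* Main.v *)
Require Import Defs.
From HB Require Import structures.
From mathcomp Require Import all_boot all_order all_algebra.
From mathcomp Require Import reals zify.
From mathcomp.real_closed Require Import complex.
From mathcomp Require Import mpoly.

Set Implicit Arguments.
Unset Strict Implicit.
Unset Printing Implicit Defensive.

Import Order.TTheory GRing.Theory Num.Theory.

Local Open Scope ring_scope.

(** Write w = t_2n, v = t_(2n-1) and u = t_(2n-2) for the three transversal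
    coordinates, and p, q, s for the last three indices, so that
    w = x_(q,1), v = x_(p,2) and u = (x_(s,1) - x_(s,2)) / 2.

    Multiplying the first Dirac equation by eps_q and the second one by eps_p
    solves them for the derivatives along w and v: a spinor is monogenic iff
    d_w psi = W psi and d_v psi = V psi, where
      W = eps_q sum_(a <> q) eps_a d_(a,1),
      V = eps_p sum_(a <> p) eps_a d_(a,2).
    This is [monogenic_evolves].  Neither W nor V contains d_w or d_v, so that
    psi is determined by its restriction psi0 to v = w = 0, and
    compatibility requires [W, V] psi0 = 0.

    The only second derivative along u in [W, V] has the coefficient
    - eps_q eps_p / 2, which is invertible; hence [W, V] psi0 = 0 is a Cauchy
    problem of order two in u ([WV_commP]).  Its Cauchy data on the subspace
    u = v = w = 0 are the values of psi and of d_u psi there, that is, the two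
    polynomial spinors in t_1, ..., t_(2n-3) of the theorem.

    There is no further condition.  By the Clifford relations W^2 and V^2 are
    scalar operators ([normal_op_sq]), so they commute with V and W, and
    [W, V] psi = 0 implies [W, V] W psi = 0 and [W, V] V psi = 0 ([W_comm] and
    [V_comm]).  The Taylor series in u, then w, then v therefore add up to a
    solution ([cauchy_solution]); the series are finite because every
    operator lowers the degree.

    Uniqueness ([cauchy_unique]) is an induction on the degree.  Derivatives
    of a monogenic spinor with zero data along the subspace and along u are
    again monogenic with zero data, so they vanish; then so do d_w psi = W psi
    and d_v psi = V psi, and psi is a constant, which its data show to be
    zero.

    Everything takes place in the polynomial ring of the x_(a,i).  The
    coordinates t enter through the parametrization [coords] of the subspace
    by t_1, ..., t_(2n-3), and vectors tangent to that subspace are those along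
    which differentiation commutes with restriction. *)

(** * Directional derivatives and the chain rule *)

Section DirectionalDerivative.
Variables (K : numFieldType) (m : nat).
Implicit Types (p q : {mpoly K[m]}) (v w : 'rV[K]_m).

Definition dder v p : {mpoly K[m]} := \sum_k v 0 k *: p^`M(k).

Lemma dder_is_linear v : linear (dder v).
Proof.
move=> c p q; rewrite /dder scaler_sumr -big_split; apply: eq_bigr => k _.
by rewrite mderivD mderivZ scalerDr !scalerA mulrC.
Qed.
HB.instance Definition _ v :=
  GRing.isLinear.Build K {mpoly K[m]} {mpoly K[m]} _ (dder v)
    (dder_is_linear v).

Lemma dderDv v w p : dder (v + w) p = dder v p + dder w p.
Proof.
by rewrite /dder -big_split; apply: eq_bigr => k _; rewrite mxE scalerDl.
Qed.

Lemma dderZv c v p : dder (c *: v) p = c *: dder v p.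
Proof.
by rewrite /dder scaler_sumr; apply: eq_bigr => k _; rewrite mxE scalerA.
Qed.

Lemma dder_delta k p : dder (delta_mx 0 k) p = p^`M(k).
Proof.
rewrite /dder (bigD1 k) //= !mxE !eqxx scale1r big1 ?addr0 // => j /negPf jk.
by rewrite mxE eqxx jk scale0r.
Qed.

Lemma dder_cst v c : dder v c%:MP = 0.
Proof. by rewrite /dder big1 // => k _; rewrite mderivC scaler0. Qed.

Lemma dderXU v k : dder v 'X_k = (v 0 k)%:MP.
Proof.
rewrite /dder (bigD1 k) //= big1 ?addr0 => [|j /negPf jk].
  rewrite mderivX mnm1E eqxx scale1r -alg_mpolyC -mpolyX0; congr (_ *: 'X_[_]).
  by apply/mnmP => j; rewrite mnmBE mnm0E subnn.
by rewrite mderivX mnm1E eq_sym jk scale0r scaler0.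
Qed.

Lemma dderM v p q : dder v (p * q) = dder v p * q + p * dder v q.
Proof.
rewrite /dder mulr_suml mulr_sumr -big_split; apply: eq_bigr => k _.
by rewrite mderivM scalerDr scalerAl scalerAr.
Qed.

Lemma dderXn v p k : dder v (p ^+ k) = (p ^+ k.-1 * dder v p) *+ k.
Proof.
elim: k => [|k IH]; first by rewrite expr0 -mpolyC1 dder_cst mulr0n.
rewrite exprS dderM IH mulrnAr mulrA -exprS mulrC /=.
by case: k {IH} => [|k]; rewrite ?mulr0n ?addr0 // -mulrS.
Qed.

Lemma dder_comm v w p : dder v (dder w p) = dder w (dder v p).
Proof.
have E v' w' : dder v' (dder w' p) =
    \sum_k \sum_j (v' 0 k * w' 0 j) *: p^`M(j)^`M(k).
  apply: eq_bigr => k _; rewrite (raddf_sum (mderiv k)) scaler_sumr.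
  by apply: eq_bigr => j _; rewrite /= mderivZ scalerA.
rewrite !E exchange_big; apply: eq_bigr => k _; apply: eq_bigr => j _.
by rewrite mulrC mderiv_comm.
Qed.

End DirectionalDerivative.

Section ChainRule.
Variables (K : numFieldType) (m l : nat) (h : m.-tuple {mpoly K[l]}).
Implicit Types (p : {mpoly K[m]}) (v : 'rV[K]_m) (w : 'rV[K]_l).

(** The chain rule for a polynomial map [h] that carries the constant field [w]
    to the constant field [v].  Both sides are derivations along
    [p |-> p \mPo h], so it suffices to compare them on the variables. *)
Lemma dder_comp v w p :
    (forall k, dder w (tnth h k) = (v 0 k)%:MP) ->
  dder w (p \mPo h) = dder v p \mPo h.
Proof.
move=> hvw; pose Q p := dder w (p \mPo h) = dder v p \mPo h.
have QM p1 p2 : Q p1 -> Q p2 -> Q (p1 * p2).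
  by rewrite /Q => Q1 Q2; rewrite rmorphM /= !dderM Q1 Q2 raddfD /= !rmorphM.
have Q1 : Q 1 by rewrite /Q rmorph1 -!mpolyC1 !dder_cst raddf0.
elim/mpolyind: p => [|c e p _ _ IH]; first by rewrite !raddf0.
rewrite !raddfD /= IH !linearZ /=; congr (_ *: _ + _).
rewrite -[LHS]/(dder w ('X_[e] \mPo h)) mpolyXE_id.
apply: (big_ind Q) => // k _.
elim: (e k) => [|d]; first by rewrite expr0.
rewrite exprS; apply: QM; rewrite /Q comp_mpolyXU dderXU comp_mpolyC -hvw.
by congr (dder _ _); rewrite (tnth_nth 0).
Qed.

Lemma comp_homog d p :
    (forall k, tnth h k \is 1.-homog) -> p \is d.-homog ->
  p \mPo h \is d.-homog.
Proof.
move=> h1 /dhomogP pd; rewrite comp_mpolyEX big_seq.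
apply: rpred_sum => e /pd ed.
apply: rpredZ; rewrite comp_mpolyX.
have -> : d = (\sum_i e i)%N by rewrite -ed; apply: mdegE.
apply: (big_ind2 (fun q n => q \is n.-homog)).
- exact: dhomog1.
- by move=> *; apply: dhomogM.
by move=> k _; have := dhomogMn (e k) (h1 k); rewrite mul1n.
Qed.

(** For a linear parametrization [h], the vectors tangent to its image. *)
Definition tangent v := exists w, forall k, dder w (tnth h k) = (v 0 k)%:MP.

End ChainRule.

(** * Degrees *)

Section Degree.
Variables (K : numFieldType) (m : nat).
Implicit Types (p q : {mpoly K[m]}) (v : 'rV[K]_m).

(** Homogeneous of degree [e - 1], and zero if [e] is 0.  With this shift
    differentiation lowers [e] to [e.-1] with no exception for constants, and
    degrees that become negative are forced to 0. *)
Definition hdeg e p := forall a : 'X_{1.. m}, (mdeg a).+1 != e -> p@_a = 0.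

Lemma hdegP d p : p \is d.-homog <-> hdeg d.+1 p.
Proof.
split=> [pd a|pd]; first by rewrite eqSS; apply: dhomog_nemf_coeff.
apply/dhomogP => a; rewrite mcoeff_msupp => pa; apply/eqP.
by apply: contraNT pa; rewrite -eqSS => /pd ->.
Qed.

Lemma hdeg0 p : hdeg 0 p -> p = 0.
Proof. by move=> p0; apply/mpolyP => a; rewrite p0 ?mcoeff0. Qed.

Lemma hdegZD e c p q : hdeg e p -> hdeg e q -> hdeg e (c *: p + q).
Proof.
by move=> pe qe a ae; rewrite mcoeffD mcoeffZ pe // qe // mulr0 addr0.
Qed.

Lemma hdeg_sum (I : Type) (s : seq I) (P : pred I) (F : I -> {mpoly K[m]}) e :
  (forall i, P i -> hdeg e (F i)) -> hdeg e (\sum_(i <- s | P i) F i).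
Proof.
move=> Fe; apply: (big_ind (hdeg e)) => // [a _|p q pe qe].
  by rewrite mcoeff0.
by rewrite -[p]scale1r; apply: hdegZD.
Qed.

Lemma hdegZ e c p : hdeg e p -> hdeg e (c *: p).
Proof.
by move=> pe; rewrite -[_ *: _]addr0; apply: hdegZD => // a; rewrite mcoeff0.
Qed.

Lemma hdeg_dder v e p : hdeg e p -> hdeg e.-1 (dder v p).
Proof.
move=> pe; apply: hdeg_sum => k _; apply: hdegZ => a ae.
rewrite mcoeff_mderiv pe ?mul0rn // mdegD mdeg1 addn1.
by case: e {pe} ae.
Qed.

Lemma mderiv_eq0_const p : (forall k, p^`M(k) = 0) -> p = (p@_0%MM)%:MP.
Proof.
move=> p0; apply/mpolyP => a; rewrite mcoeffC.
have [->|a0] := eqVneq a 0%MM; first by rewrite mulr1.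
rewrite mulr0.
have [k ak] : exists k, a k != 0%N.
  apply/existsP; apply: contraNT a0; rewrite negb_exists => /forallP a0.
  by apply/eqP/mnmP => k; rewrite mnm0E; apply/eqP; have := a0 k; rewrite negbK.
have /(congr1 (mcoeff (a - U_(k))%MM)) := p0 k.
rewrite mcoeff_mderiv submK ?mcoeff0; last by rewrite lep1mP.
by move/eqP; rewrite mulrn_eq0 => /eqP.
Qed.

End Degree.

(** * Operators on polynomial spinors *)

(** The operators are locked: otherwise comparing two spinors unfolds them down
    to enumerations of monomials and indices. *)
HB.lock Definition sder (K : numFieldType) (N m : nat) (v : 'rV[K]_m)
    (psi : {ffun 'I_N -> {mpoly K[m]}}) : {ffun 'I_N -> {mpoly K[m]}} :=
  [ffun s => dder v (psi s)].

HB.lock Definition mxact (K : numFieldType) (N m : nat) (A : 'M[K]_N)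
    (psi : {ffun 'I_N -> {mpoly K[m]}}) : {ffun 'I_N -> {mpoly K[m]}} :=
  [ffun s => \sum_s' A s s' *: psi s'].

HB.lock Definition pmul (K : numFieldType) (N m : nat) (x : {mpoly K[m]})
    (psi : {ffun 'I_N -> {mpoly K[m]}}) : {ffun 'I_N -> {mpoly K[m]}} :=
  [ffun s => x * psi s].

(** The polynomial in [x] whose derivatives along [x] at [x = 0] are the [a k],
    if these are free of [x]; the terms beyond [r] are dropped. *)
HB.lock Definition taylor (K : numFieldType) (N m : nat) (x : {mpoly K[m]})
    (r : nat) (a : nat -> {ffun 'I_N -> {mpoly K[m]}}) :
    {ffun 'I_N -> {mpoly K[m]}} :=
  \sum_(k < r.+1) pmul (k`!%:R^-1 *: x ^+ k) (a k).

Section SpinorOperators.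
Variables (K : numFieldType) (N m : nat).
Local Notation S := {ffun 'I_N -> {mpoly K[m]}}.
Implicit Types (psi phi : S) (v w : 'rV[K]_m) (A B : 'M[K]_N).

Local Notation sder := (@sder K N m).
Local Notation mxact := (@mxact K N m).
Local Notation pmul := (@pmul K N m).
Local Notation taylor := (@taylor K N m).

Lemma sderE v psi s : sder v psi s = dder v (psi s).
Proof. by rewrite sder.unlock ffunE. Qed.

Lemma mxactE A psi s : mxact A psi s = \sum_s' A s s' *: psi s'.
Proof. by rewrite mxact.unlock ffunE. Qed.

Lemma pmulE x psi s : pmul x psi s = x * psi s.
Proof. by rewrite pmul.unlock ffunE. Qed.

Lemma taylorE x r (a : nat -> S) :
  taylor x r a = \sum_(k < r.+1) pmul (k`!%:R^-1 *: x ^+ k) (a k).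
Proof. by rewrite taylor.unlock. Qed.

Local Notation opE := (sderE, mxactE, pmulE, ffunE).

Definition sdeg e psi := forall s, hdeg e (psi s).

Lemma sder_is_linear v : linear (sder v).
Proof. by move=> c f g; apply/ffunP => s; rewrite !opE linearP. Qed.
HB.instance Definition _ v :=
  GRing.isLinear.Build K S S _ (sder v) (sder_is_linear v).

Lemma mxact_is_linear A : linear (mxact A).
Proof.
move=> c f g; apply/ffunP => s; rewrite !opE scaler_sumr -big_split.
by apply: eq_bigr => s' _; rewrite !opE scalerDr !scalerA mulrC.
Qed.
HB.instance Definition _ A :=
  GRing.isLinear.Build K S S _ (mxact A) (mxact_is_linear A).

Lemma pmul_is_linear x : linear (pmul x).
Proof. by move=> c f g; apply/ffunP => s; rewrite !opE mulrDr scalerAr. Qed.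
HB.instance Definition _ x :=
  GRing.isLinear.Build K S S _ (pmul x) (pmul_is_linear x).

Lemma mxactM A B psi : mxact A (mxact B psi) = mxact (A *m B) psi.
Proof.
apply/ffunP => s; rewrite !opE.
under eq_bigr do rewrite opE scaler_sumr.
rewrite exchange_big; apply: eq_bigr => t _ /=.
by rewrite mxE scaler_suml; apply: eq_bigr => j _; rewrite scalerA.
Qed.

Lemma mxactD A B psi : mxact (A + B) psi = mxact A psi + mxact B psi.
Proof.
apply/ffunP => s; rewrite !opE -big_split; apply: eq_bigr => t _.
by rewrite mxE scalerDl.
Qed.

Lemma mxactZ c A psi : mxact (c *: A) psi = c *: mxact A psi.
Proof.
apply/ffunP => s; rewrite !opE scaler_sumr; apply: eq_bigr => t _.
by rewrite mxE scalerA.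
Qed.

Lemma mxactN A psi : mxact (- A) psi = - mxact A psi.
Proof. by rewrite -scaleN1r mxactZ scaleN1r. Qed.

Lemma mxact_scalar c psi : mxact c%:M psi = c *: psi.
Proof.
apply/ffunP => s; rewrite !opE (bigD1 s) //= mxE eqxx big1 ?addr0 //.
by move=> t /negPf ts; rewrite mxE eq_sym ts scale0r.
Qed.

Lemma sder_mxact v A psi : sder v (mxact A psi) = mxact A (sder v psi).
Proof.
apply/ffunP => s; rewrite !opE raddf_sum; apply: eq_bigr => t _.
by rewrite opE /= linearZ.
Qed.

Lemma sder_comm v w psi : sder v (sder w psi) = sder w (sder v psi).
Proof. by apply/ffunP => s; rewrite !opE dder_comm. Qed.

Lemma sderDv v w psi : sder (v + w) psi = sder v psi + sder w psi.
Proof. by apply/ffunP => s; rewrite !opE dderDv. Qed.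

Lemma sderZv c v psi : sder (c *: v) psi = c *: sder v psi.
Proof. by apply/ffunP => s; rewrite !opE dderZv. Qed.

Lemma mxact_pmul A x psi : mxact A (pmul x psi) = pmul x (mxact A psi).
Proof.
apply/ffunP => s; rewrite !opE mulr_sumr; apply: eq_bigr => t _.
by rewrite opE scalerAr.
Qed.

Lemma sder_pmul v x psi :
  sder v (pmul x psi) = pmul (dder v x) psi + pmul x (sder v psi).
Proof. by apply/ffunP => s; rewrite !opE dderM. Qed.

Lemma pmul0 psi : pmul 0 psi = 0.
Proof. by apply/ffunP => s; rewrite !opE mul0r. Qed.

Lemma sdegP d psi : (forall s, psi s \is d.-homog) <-> sdeg d.+1 psi.
Proof. by split=> h s; apply/hdegP. Qed.

Lemma sdeg0 psi : sdeg 0 psi -> psi = 0.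
Proof. by move=> h; apply/ffunP => s; rewrite opE; apply: hdeg0. Qed.

Lemma sdegD e psi phi : sdeg e psi -> sdeg e phi -> sdeg e (psi + phi).
Proof.
by move=> h1 h2 s; rewrite opE -[psi s]scale1r; apply: hdegZD.
Qed.

Lemma sdegZ e c psi : sdeg e psi -> sdeg e (c *: psi).
Proof. by move=> h s; rewrite opE; apply: hdegZ. Qed.

Lemma sdegB e psi phi : sdeg e psi -> sdeg e phi -> sdeg e (psi - phi).
Proof.
by move=> h1 h2; rewrite -scaleN1r; apply: sdegD => //; apply: sdegZ.
Qed.

Lemma sdeg_sum (I : Type) (s : seq I) (P : pred I) (F : I -> S) e :
  (forall i, P i -> sdeg e (F i)) -> sdeg e (\sum_(i <- s | P i) F i).
Proof.
move=> Fe; apply: (big_ind (sdeg e)) => //; last exact: sdegD.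
by move=> t a _; rewrite opE mcoeff0.
Qed.

Lemma sdeg_mxact e A psi : sdeg e psi -> sdeg e (mxact A psi).
Proof.
by move=> h s; rewrite opE; apply: hdeg_sum => t _; apply: hdegZ.
Qed.

Lemma sdeg_sder v e psi : sdeg e psi -> sdeg e.-1 (sder v psi).
Proof. by move=> h s; rewrite opE; apply: hdeg_dder. Qed.

Lemma eq_taylor x r a b : a =1 b -> taylor x r a = taylor x r b.
Proof. by move=> ab; rewrite !taylorE; apply: eq_bigr => k _; rewrite ab. Qed.

Lemma taylor0 x r : taylor x r (fun=> 0) = 0.
Proof. by rewrite taylorE big1 // => k _; rewrite raddf0. Qed.

Lemma taylorD x r a b :
  taylor x r (fun k => a k + b k) = taylor x r a + taylor x r b.
Proof.
by rewrite !taylorE -big_split; apply: eq_bigr => k _; rewrite raddfD.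
Qed.

Lemma taylorB x r a b :
  taylor x r (fun k => a k - b k) = taylor x r a - taylor x r b.
Proof. by rewrite !taylorE -sumrB; apply: eq_bigr => k _; rewrite raddfB. Qed.

Lemma dder_pow0 v x c k : dder v x = 0 -> dder v (c *: x ^+ k) = 0.
Proof. by move=> vx; rewrite linearZ /= dderXn vx mulr0 mul0rn scaler0. Qed.

Lemma sder_taylor0 v x r a :
  dder v x = 0 -> sder v (taylor x r a) = taylor x r (fun k => sder v (a k)).
Proof.
move=> vx; rewrite !taylorE raddf_sum; apply: eq_bigr => k _.
by rewrite /= sder_pmul dder_pow0 // pmul0 add0r.
Qed.

Lemma mxact_taylor A x r a :
  mxact A (taylor x r a) = taylor x r (fun k => mxact A (a k)).
Proof.
by rewrite !taylorE raddf_sum; apply: eq_bigr => k _; rewrite /= mxact_pmul.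
Qed.

Lemma sder_taylor1 v x r a :
    dder v x = 1 -> (forall k, sder v (a k) = 0) -> a r.+1 = 0 ->
  sder v (taylor x r a) = taylor x r (fun k => a k.+1).
Proof.
move=> vx va ar; rewrite !taylorE raddf_sum big_ord_recl [RHS]big_ord_recr /=.
rewrite !sder_pmul !va ar !raddf0 !addr0 expr0 fact0 invr1 scale1r.
rewrite -mpolyC1 dder_cst pmul0 add0r; apply: eq_bigr => k _ /=.
rewrite sder_pmul va raddf0 addr0 /bump add1n; congr pmul.
rewrite linearZ /= dderXn vx mulr1 /= -scaler_nat scalerA; congr (_ *: _).
rewrite factS natrM invfM mulrAC mulVf ?mul1r //.
by rewrite pnatr_eq0.
Qed.

Lemma sdeg_taylor x r a :
    x \is 1.-homog -> (forall k, sdeg (r.+1 - k)%N (a k)) ->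
  sdeg r.+1 (taylor x r a).
Proof.
move=> x1 ad; rewrite taylorE; apply: sdeg_sum => k _ s.
rewrite opE; apply/hdegP.
have kr : (k <= r)%N by rewrite -ltnS.
rewrite -[X in X.-homog](subnKC kr); apply: dhomogM.
  by apply: rpredZ; have := dhomogMn k x1; rewrite mul1n.
by apply/hdegP; rewrite -subSn //; apply: ad.
Qed.

(** Restriction to a subspace on which [x] vanishes keeps only the leading
    term. *)
Lemma taylor_comp l (h : m.-tuple {mpoly K[l]}) x r a s :
  x \mPo h = 0 -> taylor x r a s \mPo h = a 0 s \mPo h.
Proof.
move=> xh; rewrite taylorE sum_ffunE raddf_sum big_ord_recl.
rewrite big1 ?addr0 => [|k _].
  by rewrite /= opE expr0 fact0 invr1 scale1r mul1r.
by rewrite /= opE rmorphM /= comp_mpolyZ rmorphXn /= xh expr0n scaler0 mul0r.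
Qed.

End SpinorOperators.

(** * The equations solved for a normal derivative *)

(** With [v a] the coordinate vector of [x_(a,i)], this is the right-hand side
    of the [i]-th Dirac equation solved for the derivative along [x_(b,i)];
    other choices of [v] serve to split off the derivative along [u]. *)
HB.lock Definition normal_op (K : numFieldType) (N m n : nat)
    (eps : 'I_n -> 'M[K]_N) (b : 'I_n) (v : 'I_n -> 'rV[K]_m)
    (psi : {ffun 'I_N -> {mpoly K[m]}}) : {ffun 'I_N -> {mpoly K[m]}} :=
  \sum_(a | a != b) mxact (eps b *m eps a) (sder (v a) psi).

Section Clifford.
Variables (K : numFieldType) (N m n : nat) (eps : 'I_n -> 'M[K]_N).
Hypothesis heps :
  forall a b, eps a *m eps b + eps b *m eps a = (- (2 *+ (a == b)))%:M.
Local Notation S := {ffun 'I_N -> {mpoly K[m]}}.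
Implicit Types (psi phi : S) (v w : 'I_n -> 'rV[K]_m) (a b c : 'I_n).

Lemma two_neq0 : (2 : K) != 0.
Proof. by rewrite pnatr_eq0. Qed.

Lemma eps_sq a : eps a *m eps a = (-1)%:M.
Proof.
apply: (scalerI two_neq0); rewrite scaler_nat mulr2n heps eqxx mulr1n.
by rewrite scale_scalar_mx mulrN1.
Qed.

Lemma eps_anti a b : a != b -> eps a *m eps b = - (eps b *m eps a).
Proof.
move=> /negPf ab; apply/eqP; rewrite -subr_eq0 opprK heps ab mulr0n oppr0.
by rewrite -scalemx1 scale0r.
Qed.

Lemma mxact_eps_sq a psi : mxact (eps a) (mxact (eps a) psi) = - psi.
Proof. by rewrite mxactM eps_sq mxact_scalar scaleN1r. Qed.

Local Notation normal_op := (@normal_op K N m n eps).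

Lemma normal_opE b v psi :
  normal_op b v psi = \sum_(a | a != b) mxact (eps b *m eps a) (sder (v a) psi).
Proof. by rewrite normal_op.unlock. Qed.

Lemma normal_op_is_linear b v : linear (normal_op b v).
Proof.
move=> k f g; rewrite !normal_opE scaler_sumr -big_split; apply: eq_bigr => a _.
by rewrite /= !linearP.
Qed.
HB.instance Definition _ b v :=
  GRing.isLinear.Build K S S _ (normal_op b v) (normal_op_is_linear b v).

Lemma sder_normal_op x b v psi :
  sder x (normal_op b v psi) = normal_op b v (sder x psi).
Proof.
rewrite !normal_opE raddf_sum; apply: eq_bigr => a _.
by rewrite /= sder_mxact; congr mxact; apply: sder_comm.
Qed.

Lemma sdeg_normal_op e b v psi : sdeg e psi -> sdeg e.-1 (normal_op b v psi).
Proof.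
move=> h; rewrite normal_opE; apply: sdeg_sum => a _.
by apply: sdeg_mxact; apply: sdeg_sder.
Qed.

Lemma normal_op_eq0 b v psi :
  (forall a, a != b -> sder (v a) psi = 0) -> normal_op b v psi = 0.
Proof. by move=> h; rewrite !normal_opE big1 // => a ab; rewrite h ?raddf0. Qed.

Lemma normal_op_taylor b v x r (f : nat -> S) :
    (forall a, a != b -> dder (v a) x = 0) ->
  normal_op b v (taylor x r f) = taylor x r (fun k => normal_op b v (f k)).
Proof.
move=> h; rewrite normal_opE [RHS]taylorE.
under [RHS]eq_bigr do rewrite normal_opE raddf_sum.
rewrite exchange_big; apply: eq_bigr => a ab /=.
by rewrite sder_taylor0 ?h // mxact_taylor // taylorE.
Qed.

(** A Dirac operator squares to minus a Laplacian.  Moving [eps b] through the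
    other generators gives [eps b eps a eps b eps c = eps a eps c] for
    [a != b], and symmetrizing in [a] and [c] leaves only the diagonal. *)
Lemma normal_op_sq b v psi :
  normal_op b v (normal_op b v psi) =
  - \sum_(a | a != b) sder (v a) (sder (v a) psi).
Proof.
have -> : normal_op b v (normal_op b v psi) =
    \sum_(a | a != b) \sum_(c | c != b)
       mxact (eps a *m eps c) (sder (v a) (sder (v c) psi)).
  rewrite normal_opE; apply: eq_bigr => a ab.
  rewrite normal_opE raddf_sum raddf_sum; apply: eq_bigr => c _.
  rewrite /= sder_mxact mxactM; congr (mxact _ _).
  rewrite mulmxA -[_ *m eps b]mulmxA (eps_anti ab) mulmxN mulmxA eps_sq.
  by rewrite mul_scalar_mx scaleN1r opprK.
apply: (scalerI two_neq0); rewrite scaler_nat mulr2n.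
rewrite [X in _ + X]exchange_big -big_split scalerN scaler_sumr -sumrN.
apply: eq_bigr => a ab; rewrite -big_split /= (bigD1 a) //=.
rewrite big1 => [|c /andP[cb ca]].
  by rewrite -mxactD heps eqxx mulr1n mxact_scalar scaleNr addr0.
rewrite sder_comm -mxactD heps.
by rewrite eq_sym (negPf ca) mulr0n oppr0 mxact_scalar scale0r.
Qed.

Lemma normal_op_sq_comm b c v w psi :
  normal_op c w (normal_op b v (normal_op b v psi)) =
  normal_op b v (normal_op b v (normal_op c w psi)).
Proof.
rewrite !normal_op_sq (raddfN (normal_op c w)) (raddf_sum (normal_op c w)).
congr (- _); apply: eq_bigr => a _.
by rewrite /= !sder_normal_op.
Qed.

End Clifford.

Lemma ord2P (i : 'I_2) : i = 0 \/ i = 1.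
Proof. by case: i => [[|[|//]] ?]; [left|right]; apply: val_inj. Qed.

Lemma mxvec_index_eq m n (a b : 'I_m) (i j : 'I_n) :
  (mxvec_index a i == mxvec_index b j) = (a == b) && (i == j).
Proof.
apply/eqP/andP => [ab|[/eqP-> /eqP->]] //.
have /matrixP /(_ b j) : delta_mx a i = delta_mx b j :> 'M[int]_(m, n).
  by apply: (can_inj mxvecK); rewrite !mxvec_delta ab.
rewrite !mxE !eqxx [b == a]eq_sym [j == i]eq_sym.
by do 2!case: eqP.
Qed.

(** * The compatibility condition of the two equations *)

Section TwoDirac.
Variables (K : numFieldType) (N n : nat) (eps : 'I_n -> 'M[K]_N).
Hypothesis heps :
  forall a b, eps a *m eps b + eps b *m eps a = (- (2 *+ (a == b)))%:M.
Local Notation S := {ffun 'I_N -> {mpoly K[n * 2]}}.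
Variables p q s : 'I_n.
Hypotheses (pq : p != q) (ps : p != s) (qs : q != s).
Implicit Types (psi phi : S) (a b : 'I_n) (i : 'I_2).

Definition basis_vec a i : 'rV[K]_(n * 2) := delta_mx 0 (mxvec_index a i).

Lemma sum_dirac_eq0 b i psi :
  \sum_a mxact (eps a) (sder (basis_vec a i) psi) = 0 <->
  sder (basis_vec b i) psi = normal_op eps b (basis_vec^~ i) psi.
Proof.
have <- : mxact (eps b)
      (\sum_(a | a != b) mxact (eps a) (sder (basis_vec a i) psi)) =
    normal_op eps b (basis_vec^~ i) psi.
  by rewrite normal_opE raddf_sum; apply: eq_bigr => a _; rewrite /= mxactM.
rewrite (bigD1 b) //=; split=> [|->].
  move/(congr1 (mxact (eps b))).
  rewrite raddfD raddf0 /= mxact_eps_sq // => /eqP.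
  by rewrite addrC subr_eq0 => /eqP.
by rewrite mxact_eps_sq // addNr.
Qed.

(** These are the coordinate fields of [t_(2n-2)] and [t_(2n-3)], since
    [x_(s,1) = t_(2n-3) + t_(2n-2)] and [x_(s,2) = t_(2n-3) - t_(2n-2)]. *)
Definition dir_u := basis_vec s 0 - basis_vec s 1.
Definition dir_c := basis_vec s 0 + basis_vec s 1.
(** The coordinate vector of [x_(a,i)] without its component along [dir_u]. *)
Definition tangential i a := if a == s then 2^-1 *: dir_c else basis_vec a i.

Local Notation W := (normal_op (m := n * 2) eps q (basis_vec^~ 0)).
Local Notation V := (normal_op (m := n * 2) eps p (basis_vec^~ 1)).
Local Notation W0 := (normal_op (m := n * 2) eps q (tangential 0)).
Local Notation V0 := (normal_op (m := n * 2) eps p (tangential 1)).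

Lemma normal_op_split b i k psi :
    b != s -> basis_vec s i = 2^-1 *: dir_c + k *: dir_u ->
  normal_op eps b (basis_vec^~ i) psi =
  normal_op eps b (tangential i) psi +
  mxact (k *: (eps b *m eps s)) (sder dir_u psi).
Proof.
move=> bs Es; rewrite !normal_opE (bigD1 s) 1?eq_sym //=.
rewrite [in RHS](bigD1 s) 1?eq_sym //= {1}/tangential eqxx.
rewrite Es sderDv raddfD /= (sderZv k) linearZ mxactZ addrAC; congr (_ + _ + _).
by apply: eq_bigr => a /andP[_ /negPf as_]; rewrite /tangential as_.
Qed.

(** The coefficients of the derivative along [dir_u] in [W] and [V]. *)
Definition coef_W : 'M[K]_N := 2^-1 *: (eps q *m eps s).
Definition coef_V : 'M[K]_N := - 2^-1 *: (eps p *m eps s).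

Lemma half_add_half : 2^-1 + 2^-1 = 1 :> K.
Proof. by rewrite -[LHS]mulr2n -[LHS]mulr_natl mulfV ?two_neq0. Qed.

Lemma W_split psi : W psi = W0 psi + mxact coef_W (sder dir_u psi).
Proof.
apply: normal_op_split => //.
rewrite /dir_c /dir_u scalerDr scalerBr addrACA subrr addr0.
by rewrite -scalerDl half_add_half scale1r.
Qed.

Lemma V_split psi : V psi = V0 psi + mxact coef_V (sder dir_u psi).
Proof.
apply: normal_op_split => //.
rewrite /dir_c /dir_u scalerDr scalerBr !scaleNr opprK addrACA subrr add0r.
by rewrite -scalerDl half_add_half scale1r.
Qed.

Definition coef_uu : 'M[K]_N := 2^-1 *: (eps q *m eps p).
Definition inv_uu : 'M[K]_N := - 2 *: (eps q *m eps p).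
(** These two operators only differentiate along tangential vectors; they are
    obtained by solving [[W, V] psi = 0] for the second derivative of [psi]
    along [dir_u]. *)
Definition cauchy0 psi := mxact inv_uu (W0 (V0 psi) - V0 (W0 psi)).
Definition cauchy1 phi :=
  mxact inv_uu (mxact coef_W (V0 phi) + W0 (mxact coef_V phi) -
                V0 (mxact coef_W phi) - mxact coef_V (W0 phi)).

Lemma eps_qp_sq : (eps q *m eps p) *m (eps q *m eps p) = (-1)%:M.
Proof.
rewrite mulmxA -[_ *m eps q]mulmxA (eps_anti heps pq) mulmxN mulmxA.
rewrite (eps_sq heps) mulNmx mul_scalar_mx scaleN1r mulNmx opprK.
exact: eps_sq.
Qed.

Lemma coef_uuK : coef_uu *m inv_uu = 1%:M.
Proof.
rewrite /coef_uu /inv_uu -scalemxAl -scalemxAr scalerA eps_qp_sq.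
by rewrite scale_scalar_mx mulrN1 mulrN opprK mulVf ?two_neq0.
Qed.

Lemma inv_uuK : inv_uu *m coef_uu = 1%:M.
Proof. exact: mulmx1C coef_uuK. Qed.

Lemma coef_comm : coef_W *m coef_V - coef_V *m coef_W = - coef_uu.
Proof.
have ss a b : a != s -> b != s ->
    (eps a *m eps s) *m (eps b *m eps s) = eps a *m eps b.
  move=> as_ bs; rewrite mulmxA -[_ *m eps b]mulmxA (eps_anti heps (a := s)).
    rewrite mulmxN mulmxA mulNmx -mulmxA (eps_sq heps) mul_mx_scalar.
    by rewrite scaleN1r opprK.
  by rewrite eq_sym.
rewrite /coef_W /coef_V /coef_uu -!scalemxAl -!scalemxAr !ss //.
rewrite !scalerA mulrN mulNr.
rewrite (eps_anti heps pq) scalerN !scaleNr !opprK -opprD -scalerDl -mulrDl.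
by rewrite half_add_half mul1r.
Qed.

(** Expand [W = W0 + coef_W d_u] and [V = V0 + coef_V d_u]: the coefficient of
    [d_u^2] is the commutator of the matrices [coef_W] and [coef_V]. *)
Lemma WV_comm psi :
  W (V psi) - V (W psi) =
  mxact coef_uu
    (cauchy0 psi + cauchy1 (sder dir_u psi) - sder dir_u (sder dir_u psi)).
Proof.
have uuK x : mxact coef_uu (mxact inv_uu x) = x.
  by rewrite mxactM coef_uuK mxact_scalar scale1r.
have uu_comm x : mxact coef_uu x =
    mxact (coef_V *m coef_W) x - mxact (coef_W *m coef_V) x.
  by rewrite -[coef_uu]opprK -coef_comm mxactN mxactD mxactN opprB.
rewrite (raddfB (mxact coef_uu)) (raddfD (mxact coef_uu)) /= !uuK uu_comm.
rewrite W_split [V (W psi)]V_split V_split [W psi]W_split.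
rewrite !(raddfD (sder dir_u)) !(raddfD W0) !(raddfD V0) /=.
rewrite !sder_mxact !(raddfD (mxact coef_W)) !(raddfD (mxact coef_V)) /=.
rewrite !mxactM.
rewrite !(sder_normal_op eps) !opprD !opprK !addrA.
by rewrite [LHS](ACl (1 * 5 * 3 * 2 * 6 * 7 * 8 * 4)).
Qed.

Lemma WV_commP psi :
  W (V psi) = V (W psi) <->
  sder dir_u (sder dir_u psi) = cauchy0 psi + cauchy1 (sder dir_u psi).
Proof.
have := WV_comm psi; set d := _ - sder dir_u _ => WVd.
split=> [WV|d0].
  apply/esym/eqP; rewrite -subr_eq0 -/d -[d]scale1r -mxact_scalar -inv_uuK.
  by rewrite -mxactM -WVd WV subrr raddf0.
by apply/eqP; rewrite -subr_eq0 WVd /d -d0 subrr raddf0.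
Qed.

(** The kernel of [[W, V]] is stable under [W]: as [W^2] commutes with [V],
    [W V W psi = W W V psi = V W W psi].  The same holds for [V]. *)
Lemma W_comm psi : W (V psi) = V (W psi) -> W (V (W psi)) = V (W (W psi)).
Proof. by move=> <-; rewrite normal_op_sq_comm. Qed.

Lemma V_comm psi : W (V psi) = V (W psi) -> W (V (V psi)) = V (W (V psi)).
Proof. by move=> ->; rewrite normal_op_sq_comm. Qed.

(** * Existence *)

Definition coordX a i : {mpoly K[n * 2]} := 'X_(mxvec_index a i).

Lemma dder_coordX a i b j :
  dder (basis_vec a i) (coordX b j) = if (a == b) && (i == j) then 1 else 0.
Proof.
rewrite dderXU mxE eqxx mxvec_index_eq [b == a]eq_sym [j == i]eq_sym /=.
by case: ifP => _; rewrite ?mpolyC0 ?mpolyC1.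
Qed.

Definition xu : {mpoly K[n * 2]} := 2^-1 *: (coordX s 0 - coordX s 1).

Lemma dder_xu x :
  dder x xu = 2^-1 *: (dder x (coordX s 0) - dder x (coordX s 1)).
Proof. by rewrite linearZ linearB. Qed.

Lemma dder_basis_xu a i : a != s -> dder (basis_vec a i) xu = 0.
Proof.
by move=> /negPf as_; rewrite dder_xu !dder_coordX as_ subr0 scaler0.
Qed.

Lemma dder_dc_xu : dder dir_c xu = 0.
Proof.
rewrite dderDv !dder_xu !dder_coordX !eqxx /= -scalerDr.
by rewrite sub0r subr0 subrr scaler0.
Qed.

Lemma dder_du_xu : dder dir_u xu = 1.
Proof.
rewrite /dir_u -scaleN1r dderDv dderZv !dder_xu !dder_coordX !eqxx /=.
by rewrite sub0r subr0 scalerN scaleN1r opprK -scalerDl half_add_half scale1r.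
Qed.

Lemma dder_tang_xu i a : dder (tangential i a) xu = 0.
Proof.
rewrite /tangential; case: ifPn => [_|]; last exact: dder_basis_xu.
by rewrite dderZv dder_dc_xu scaler0.
Qed.

Lemma coordX_homog a i : coordX a i \is 1.-homog.
Proof. by rewrite dhomogX /= mdeg1. Qed.

Lemma xu_homog : xu \is 1.-homog.
Proof. by apply: rpredZ; apply: rpredB; apply: coordX_homog. Qed.

(** The monogenic spinors, by [monogenic_evolves] below. *)
Definition evolves psi :=
  sder (basis_vec q 0) psi = W psi /\ sder (basis_vec p 1) psi = V psi.

Lemma sder_cauchy0 x psi : sder x (cauchy0 psi) = cauchy0 (sder x psi).
Proof. by rewrite sder_mxact raddfB /= !sder_normal_op. Qed.

Lemma sder_cauchy1 x psi : sder x (cauchy1 psi) = cauchy1 (sder x psi).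
Proof.
rewrite /cauchy1 sder_mxact !(raddfB (sder x)) (raddfD (sder x)) /=.
by rewrite !(sder_mxact, sder_normal_op).
Qed.

Lemma sdeg_cauchy0 e psi : sdeg e psi -> sdeg e.-2 (cauchy0 psi).
Proof.
by move=> pe; apply: sdeg_mxact; apply: sdegB; do 2!apply: sdeg_normal_op.
Qed.

Lemma sdeg_cauchy1 e psi : sdeg e psi -> sdeg e.-1 (cauchy1 psi).
Proof.
move=> pe; apply: sdeg_mxact; apply: sdegB; first apply: sdegB;
  first apply: sdegD.
- by apply: sdeg_mxact; apply: sdeg_normal_op.
- by apply: sdeg_normal_op; apply: sdeg_mxact.
- by apply: sdeg_normal_op; apply: sdeg_mxact.
by apply: sdeg_mxact; apply: sdeg_normal_op.
Qed.

Lemma cauchy0_taylor r (a : nat -> S) :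
  cauchy0 (taylor xu r a) = taylor xu r (fun k => cauchy0 (a k)).
Proof.
rewrite /cauchy0 -mxact_taylor taylorB.
by rewrite !normal_op_taylor // => *; apply: dder_tang_xu.
Qed.

Lemma cauchy1_taylor r (a : nat -> S) :
  cauchy1 (taylor xu r a) = taylor xu r (fun k => cauchy1 (a k)).
Proof.
rewrite /cauchy1 -mxact_taylor !taylorB taylorD.
congr (mxact _ (_ + _ - _ - _));
  rewrite ?mxact_taylor normal_op_taylor ?mxact_taylor // => *;
  exact: dder_tang_xu.
Qed.

(** The exponential series of [normal_op eps b v] in the coordinate [x] solves
    the evolution equation along [y]; it is finite because the operator lowers
    the degree. *)
Lemma flow_solution b v y x r psi :
    (forall a, a != b -> dder (v a) x = 0) -> dder y x = 1 -> x \is 1.-homog ->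
    sder y psi = 0 -> sdeg r.+1 psi ->
  let phi := taylor x r (fun k => iter k (normal_op eps b v) psi) in
  sder y phi = normal_op eps b v phi /\ sdeg r.+1 phi.
Proof.
move=> vx yx x1 ypsi dpsi phi.
have dpsik k : sdeg (r.+1 - k)%N (iter k (normal_op eps b v) psi).
  elim: k => [|k IH]; first by rewrite subn0.
  by rewrite subnS; apply: sdeg_normal_op.
split; last exact: sdeg_taylor.
rewrite sder_taylor1 ?normal_op_taylor //; last first.
  by apply: sdeg0; have := dpsik r.+1; rewrite subnn.
elim=> // k IH; by rewrite iterS sder_normal_op IH raddf0.
Qed.

Section Existence.
Variables (r : nat) (f g : S).
Hypotheses (fu : sder dir_u f = 0) (fq : sder (basis_vec q 0) f = 0)
  (fp : sder (basis_vec p 1) f = 0).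
Hypotheses (gu : sder dir_u g = 0) (gq : sder (basis_vec q 0) g = 0)
  (gp : sder (basis_vec p 1) g = 0).
Hypotheses (df : sdeg r.+1 f) (dg : sdeg r g).

Variable a : nat -> S.
Hypotheses (a0 : a 0 = f) (a1 : a 1 = g).
Hypothesis aSS : forall k, a k.+2 = cauchy0 (a k) + cauchy1 (a k.+1).

Let a_killed x : sder x f = 0 -> sder x g = 0 -> forall k, sder x (a k) = 0.
Proof.
move=> xf xg k; suff [? _] : sder x (a k) = 0 /\ sder x (a k.+1) = 0 by [].
elim: k => [|k [IH1 IH2]]; first by rewrite a0 a1.
split; first exact: IH2.
rewrite aSS raddfD /= sder_cauchy0 sder_cauchy1 IH1 IH2.
by rewrite /cauchy0 /cauchy1 !(raddf0, addr0).
Qed.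

Let da k : sdeg (r.+1 - k)%N (a k).
Proof.
suff [? _] : sdeg (r.+1 - k)%N (a k) /\ sdeg (r.+1 - k.+1)%N (a k.+1) by [].
elim: k => [|k [IH1 IH2]]; first by rewrite a0 a1 subn0 subn1.
split; first exact: IH2.
rewrite aSS; apply: sdegD; last by rewrite subnS; apply: sdeg_cauchy1.
by rewrite 2!subnS; apply: sdeg_cauchy0.
Qed.

Let a_end k : (r < k)%N -> a k = 0.
Proof.
by rewrite -subn_eq0 => /eqP rk; apply: sdeg0; have := @da k; rewrite rk.
Qed.

(** The three expansions: [psi0] in [xu], [psi1] in [coordX q 0] and [psi] in
    [coordX p 1].  A stage does not depend on the coordinates of the stages
    that follow it. *)
Let psi0 := taylor xu r a.

Let du_psi0 : sder dir_u psi0 = taylor xu r (fun k => a k.+1).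
Proof.
by apply: sder_taylor1; rewrite ?dder_du_xu ?a_end //; apply: a_killed.
Qed.

Let psi0_comm : W (V psi0) = V (W psi0).
Proof.
apply/WV_commP; rewrite du_psi0 cauchy0_taylor cauchy1_taylor -taylorD.
transitivity (taylor xu r (fun k => a k.+2)); last exact: eq_taylor.
by rewrite (sder_taylor1 (a := fun k => a k.+1)) ?dder_du_xu ?a_end // => k;
  apply: a_killed.
Qed.

Let psi0_killed x :
  dder x xu = 0 -> sder x f = 0 -> sder x g = 0 -> sder x psi0 = 0.
Proof.
move=> xx xf xg; rewrite sder_taylor0 // -[RHS](taylor0 N xu r).
by apply: eq_taylor; apply: a_killed.
Qed.

Let psi1 := taylor (coordX q 0) r (fun k => iter k W psi0).

Let psi1_spec : sder (basis_vec q 0) psi1 = W psi1 /\ sdeg r.+1 psi1.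
Proof.
apply: flow_solution.
- by move=> b bq; rewrite dder_coordX (negPf bq).
- by rewrite dder_coordX !eqxx.
- exact: coordX_homog.
- by apply: psi0_killed => //; apply: dder_basis_xu.
by apply: sdeg_taylor; first exact: xu_homog.
Qed.

(** [[W, V]] commutes with the expansion in [coordX q 0], and annihilates each
    [W^k psi0] by [W_comm]. *)
Let psi1_comm : W (V psi1) = V (W psi1).
Proof.
have V_taylor (b : nat -> S) :
    V (taylor (coordX q 0) r b) = taylor (coordX q 0) r (V \o b).
  by apply: normal_op_taylor => c _; rewrite dder_coordX andbF.
have W_taylor (b : nat -> S) :
    W (taylor (coordX q 0) r b) = taylor (coordX q 0) r (W \o b).
  by apply: normal_op_taylor => c cq; rewrite dder_coordX (negPf cq).
rewrite !(V_taylor, W_taylor); apply: eq_taylor => k /=.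
by elim: k => [|k IH]; [exact: psi0_comm|rewrite iterS; apply: W_comm].
Qed.

Let psi1_p : sder (basis_vec p 1) psi1 = 0.
Proof.
rewrite sder_taylor0 ?dder_coordX ?(negPf pq) //.
rewrite -[RHS](taylor0 N (coordX q 0) r); apply: eq_taylor; elim=> [|k IH].
  by apply: psi0_killed => //; apply: dder_basis_xu.
by rewrite iterS sder_normal_op IH raddf0.
Qed.

Let psi := taylor (coordX p 1) r (fun k => iter k V psi1).

Lemma taylor_cauchy_solution :
  exists psi : S, [/\ evolves psi, sdeg r.+1 psi &
    forall l (h : (n * 2).-tuple {mpoly K[l]}) t,
      xu \mPo h = 0 -> coordX q 0 \mPo h = 0 -> coordX p 1 \mPo h = 0 ->
    psi t \mPo h = f t \mPo h /\ sder dir_u psi t \mPo h = g t \mPo h].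
Proof.
have [psi1q dpsi1] := psi1_spec.
have [psip dpsi] : sder (basis_vec p 1) psi = V psi /\ sdeg r.+1 psi.
  apply: flow_solution.
  - by move=> b bp; rewrite dder_coordX (negPf bp).
  - by rewrite dder_coordX !eqxx.
  - exact: coordX_homog.
  - exact: psi1_p.
  exact: dpsi1.
exists psi; split=> //.
  split=> //; rewrite sder_taylor0; last first.
    by rewrite dder_coordX eq_sym (negPf pq).
  rewrite normal_op_taylor; last by move=> b _; rewrite dder_coordX andbF.
  apply: eq_taylor => k.
  (* Moving W through V^k is possible because V^k psi1 stays in the kernel of
     the commutator. *)
  have [] : sder (basis_vec q 0) (iter k V psi1) = W (iter k V psi1) /\
            W (V (iter k V psi1)) = V (W (iter k V psi1)) => //.
  elim: k => [|k [IH1 IH2]]; first by split; [exact: psi1q|exact: psi1_comm].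
  rewrite iterS; split; last exact: V_comm.
  by rewrite sder_normal_op IH1 IH2.
move=> l h t hu hq hp; split; first by rewrite !taylor_comp //= a0.
rewrite sder_taylor0; last first.
  rewrite /dir_u -scaleN1r dderDv dderZv !dder_coordX.
  by rewrite ![s == p]eq_sym (negPf ps) scaler0 addr0.
rewrite taylor_comp // sder_taylor0; last first.
  rewrite /dir_u -scaleN1r dderDv dderZv !dder_coordX.
  by rewrite ![s == q]eq_sym (negPf qs) scaler0 addr0.
by rewrite taylor_comp //= du_psi0 taylor_comp //= a1.
Qed.

End Existence.

(** The data [f] and [g] are given as spinors in all variables that are
    constant in the three transversal directions. *)
Lemma cauchy_solution r f g :
    (forall x, x \in [:: dir_u; basis_vec q 0; basis_vec p 1] ->
      sder x f = 0 /\ sder x g = 0) ->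
    sdeg r.+1 f -> sdeg r g ->
  exists psi : S, [/\ evolves psi, sdeg r.+1 psi &
    forall l (h : (n * 2).-tuple {mpoly K[l]}) t,
      xu \mPo h = 0 -> coordX q 0 \mPo h = 0 -> coordX p 1 \mPo h = 0 ->
    psi t \mPo h = f t \mPo h /\ sder dir_u psi t \mPo h = g t \mPo h].
Proof.
move=> fg df dg.
(* A pair holds two consecutive terms of the sequence of derivatives along
   dir_u prescribed by the second-order equation. *)
pose pairs k :=
  iter k (fun xy : S * S => (xy.2, cauchy0 xy.1 + cauchy1 xy.2)) (f, g).
have [|fu gu] := fg dir_u; first by rewrite !inE eqxx.
have [|fq gq] := fg (basis_vec q 0); first by rewrite !inE eqxx orbT.
have [|fp gp] := fg (basis_vec p 1); first by rewrite !inE eqxx !orbT.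
exact: (@taylor_cauchy_solution r f g fu fq fp gu gq gp df dg
  (fun k => (pairs k).1)).
Qed.

(** * Uniqueness *)

Lemma sder_evolves x psi : evolves psi -> evolves (sder x psi).
Proof.
move=> [psiq psip]; split; rewrite sder_comm.
  by rewrite psiq sder_normal_op.
by rewrite psip sder_normal_op.
Qed.

(** Induction on the degree, applied to the derivatives of [psi].  Those along
    tangent vectors have zero data because differentiation commutes with the
    restriction; for the one along [dir_u], the second datum vanishes by
    [WV_commP], whose right-hand side only involves tangential derivatives. *)
Lemma cauchy_unique l (h : (n * 2).-tuple {mpoly K[l]}) :
    (forall a i, a != s -> (a, i) != (q, 0) -> (a, i) != (p, 1) ->
      tangent h (basis_vec a i)) ->
    tangent h dir_c ->
  forall r psi, sdeg r psi -> evolves psi ->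
    (forall t, psi t \mPo h = 0) -> (forall t, sder dir_u psi t \mPo h = 0) ->
  psi = 0.
Proof.
move=> tE tc; elim=> [|r IH] psi dpsi mpsi psih dpsih; first exact: sdeg0.
have tan0 x : tangent h x -> sder x psi = 0.
  have comp0 phi : tangent h x -> (forall t, phi t \mPo h = 0) ->
      forall t, sder x phi t \mPo h = 0.
    move=> [w hw] phih t; rewrite sderE -(dder_comp _ hw).
    by rewrite [_ \mPo h]phih linear0.
  move=> tx; apply: IH; first exact: (sdeg_sder x dpsi).
  - exact: sder_evolves.
  - exact: comp0.
  by rewrite sder_comm; apply: comp0.
have tang_W a : a != q -> sder (tangential 0 a) psi = 0.
  move=> aq; rewrite /tangential; case: ifPn => [_|as_].
    by rewrite sderZv tan0 ?scaler0.
  by apply: tan0; apply: tE => //; rewrite xpair_eqE ?(negPf aq) ?andbF.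
have tang_V a : a != p -> sder (tangential 1 a) psi = 0.
  move=> ap; rewrite /tangential; case: ifPn => [_|as_].
    by rewrite sderZv tan0 ?scaler0.
  by apply: tan0; apply: tE => //; rewrite xpair_eqE ?(negPf ap) ?andbF.
have du0 : sder dir_u psi = 0.
  apply: IH; first exact: (sdeg_sder dir_u dpsi).
  - exact: sder_evolves.
  - exact: dpsih.
  have W0psi : W0 psi = 0 by apply: normal_op_eq0.
  have V0psi : V0 psi = 0 by apply: normal_op_eq0.
  have W0mxact x : W0 (mxact x (sder dir_u psi)) = 0.
    apply: normal_op_eq0 => a aq.
    by rewrite sder_mxact sder_comm tang_W // !raddf0.
  have V0mxact x : V0 (mxact x (sder dir_u psi)) = 0.
    apply: normal_op_eq0 => a ap.
    by rewrite sder_mxact sder_comm tang_V // !raddf0.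
  have WV : W (V psi) = V (W psi).
    case: mpsi => psiq psip.
    by rewrite -psip -psiq -!sder_normal_op -psip -psiq sder_comm.
  move=> t; have /WV_commP -> := WV.
  rewrite /cauchy1 W0mxact V0mxact -!sder_normal_op W0psi V0psi.
  by rewrite /cauchy0 W0psi V0psi !(raddf0, addr0) ffunE raddf0.
have basis0 a i : (a, i) != (q, 0) -> (a, i) != (p, 1) ->
    sder (basis_vec a i) psi = 0.
  move=> aiq aip; have [as_|as_] := eqVneq a s; last exact/tan0/tE.
  have dc0 := tan0 dir_c tc; rewrite as_.
  have [->|->] := ord2P i.
    have -> : basis_vec s 0 = 2^-1 *: (dir_c + dir_u).
      rewrite /dir_c /dir_u addrACA subrr addr0 scalerDr -scalerDl.
      by rewrite half_add_half scale1r.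
    by rewrite sderZv sderDv dc0 du0 addr0 scaler0.
  have -> : basis_vec s 1 = 2^-1 *: (dir_c - dir_u).
    rewrite /dir_c /dir_u opprB addrC addrA subrK scalerDr -scalerDl.
    by rewrite half_add_half scale1r.
  by rewrite sderZv -scaleN1r sderDv sderZv dc0 du0 scaler0 addr0 scaler0.
have basis_all a i : sder (basis_vec a i) psi = 0.
  have [psiq psip] := mpsi.
  have [[-> ->]|aiq] := eqVneq (a, i) (q, 0).
    rewrite psiq; apply: normal_op_eq0 => b bq.
    by apply: basis0; rewrite xpair_eqE ?(negPf bq) ?andbF.
  have [[-> ->]|aip] := eqVneq (a, i) (p, 1); last exact: basis0.
  rewrite psip; apply: normal_op_eq0 => b bp.
  by apply: basis0; rewrite xpair_eqE ?(negPf bp) ?andbF.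
apply/ffunP => t; rewrite ffunE; have := psih t.
have -> : psi t = ((psi t)@_0%MM)%:MP; last first.
  rewrite comp_mpolyC => /eqP; rewrite mpolyC_eq0 => /eqP ->.
  by rewrite mpolyC0.
apply: mderiv_eq0_const => k; case/mxvec_indexP: k => a i.
by have /ffunP /(_ t) := basis_all a i; rewrite sderE ffunE dder_delta.
Qed.

End TwoDirac.

(** * The coordinates t *)

Section Coordinates.
Variables (n : nat).

(** The entries of the matrix of the [x_(a,i)] as a formula in the [t_k], for
    values [t_k] in any additive group.  It commutes with additive maps, so it
    can be differentiated and restricted by acting on the [t_k]. *)
Definition xform (V : zmodType) (t : nat -> V) (a : 'I_n) (i : 'I_2) : V :=
  let al := a.+1 in
  if (al <= n - 3)%N then
    if i == 0 then t (2 * al - 1)%N else t (2 * al)%N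
  else if al == (n - 2)%N then
    if i == 0 then t (2 * n - 5)%N else t (2 * n - 1)%N
  else if al == (n - 1)%N then
    if i == 0 then t (2 * n)%N else t (2 * n - 4)%N
  else
    if i == 0 then t (2 * n - 3)%N + t (2 * n - 2)%N
    else t (2 * n - 3)%N - t (2 * n - 2)%N.

Lemma raddf_xform (U V : zmodType) (f : {additive U -> V}) t a i :
  f (xform t a i) = xform (f \o t) a i.
Proof.
by rewrite /xform /=; do !case: ifP => _ //=; rewrite ?raddfB ?raddfD.
Qed.

Lemma eq_xform (V : zmodType) (t t' : nat -> V) a i :
  t =1 t' -> xform t a i = xform t' a i.
Proof. by move=> tt; rewrite /xform !tt. Qed.

Hypothesis hn : (3 <= n)%N.

Let ltp : (n - 3 < n)%N. Proof. by lia. Qed.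
Let ltq : (n - 2 < n)%N. Proof. by lia. Qed.
Let lts : (n - 1 < n)%N. Proof. by lia. Qed.
Definition ix_p : 'I_n := Ordinal ltp.
Definition ix_q : 'I_n := Ordinal ltq.
Definition ix_s : 'I_n := Ordinal lts.

Lemma ix_pq : ix_p != ix_q. Proof. by rewrite -val_eqE /=; lia. Qed.
Lemma ix_ps : ix_p != ix_s. Proof. by rewrite -val_eqE /=; lia. Qed.
Lemma ix_qs : ix_q != ix_s. Proof. by rewrite -val_eqE /=; lia. Qed.

(** The [k] with [x_(a,i) = t_k], for the entries equal to one of
    [t_1, ..., t_(2n-4)]; its values elsewhere are junk. *)
Definition tindex (a : 'I_n) (i : 'I_2) : nat :=
  if (a.+1 <= n - 3)%N then if i == 0 then (2 * a.+1 - 1)%N else (2 * a.+1)%N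
  else if a.+1 == (n - 2)%N then (2 * n - 5)%N else (2 * n - 4)%N.

Lemma xform_coord (V : zmodType) (t : nat -> V) a i :
    a != ix_s -> (a, i) != (ix_q, 0) -> (a, i) != (ix_p, 1) ->
  xform t a i = t (tindex a i).
Proof.
rewrite !xpair_eqE /xform /tindex -!val_eqE /= => as_ aq ap.
have [a1|a1] := boolP (a.+1 <= n - 3)%N; first by case: ifP.
have [a2|a2] := boolP (a.+1 == n - 2)%N.
  by case: ifP => // i0; exfalso; have := ltn_ord i; lia.
have [a3|a3] := boolP (a.+1 == n - 1)%N; last first.
  by exfalso; have := ltn_ord a; lia.
by case: ifP => // i0; exfalso; have := ltn_ord i; lia.
Qed.

Lemma xform_c0 (V : zmodType) (t : nat -> V) :
  xform t ix_s 0 = t (2 * n - 3)%N + t (2 * n - 2)%N.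
Proof.
rewrite /xform /= ifN; last by lia.
by rewrite ifN; last lia; rewrite ifN; last lia.
Qed.

Lemma xform_c1 (V : zmodType) (t : nat -> V) :
  xform t ix_s 1 = t (2 * n - 3)%N - t (2 * n - 2)%N.
Proof.
rewrite /xform /= ifN; last by lia.
by rewrite ifN; last lia; rewrite ifN; last lia.
Qed.

Lemma xform_q (V : zmodType) (t : nat -> V) : xform t ix_q 0 = t (2 * n)%N.
Proof.
rewrite /xform /= ifN; last by lia.
by rewrite ifN; last lia; rewrite ifT //; lia.
Qed.

Lemma xform_p (V : zmodType) (t : nat -> V) : xform t ix_p 1 = t (2 * n - 1)%N.
Proof.
rewrite /xform /= ifN; last by lia.
by rewrite ifT //; lia.
Qed.

End Coordinates.

(** * The initial data *)

Lemma comp_mpolyA (K : numFieldType) m l k (p : {mpoly K[m]})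
    (g : m.-tuple {mpoly K[l]}) (h : l.-tuple {mpoly K[k]}) :
  (p \mPo g) \mPo h = p \mPo [tuple tnth g i \mPo h | i < m].
Proof.
rewrite [p \mPo g]comp_mpolyEX [RHS]comp_mpolyEX raddf_sum.
apply: eq_bigr => e _.
rewrite /= comp_mpolyZ !comp_mpolyX; congr (_ *: _).
by rewrite rmorph_prod; apply: eq_bigr => i _; rewrite rmorphXn tnth_mktuple.
Qed.

Lemma comp_section (K : numFieldType) m l (f : {mpoly K[l]})
    (g : l.-tuple {mpoly K[m]}) (h : m.-tuple {mpoly K[l]}) :
  (forall k, tnth g k \mPo h = 'X_k) -> (f \mPo g) \mPo h = f.
Proof.
move=> gh; rewrite comp_mpolyA.
have -> : [tuple tnth g i \mPo h | i < l] = [tuple 'X_i | i < l].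
  by apply: eq_from_tnth => k; rewrite !tnth_mktuple.
exact: comp_mpoly_id.
Qed.

Section InitialData.
Variables (R : realType) (N n : nat).
Local Notation K := (R[i]).
Local Notation "t_[ m ]" := (@tvar R m) (at level 0, m at level 200).

Lemma dder_tvar m (j : 'I_m) k :
  dder (delta_mx 0 j) (t_[m] k) = if j.+1 == k then 1 else 0.
Proof.
rewrite /tvar raddf_sum /=.
rewrite (eq_bigr (fun i => if i == j then 1 else 0)); last first.
  move=> i _; rewrite dderXU mxE eqxx.
  by case: eqP; rewrite /= ?mpolyC0 ?mpolyC1.
rewrite -big_mkcondr /=; case: ifP => jk.
  by rewrite (big_pred1 j) // => i; rewrite andb_idl // => /eqP ->.
rewrite big_pred0 // => i; apply/negP => /andP[ik /eqP ij].
by rewrite -ij ik in jk.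
Qed.

Lemma tvar_ord m (j : 'I_m) : t_[m] j.+1 = 'X_j.
Proof. by rewrite /tvar (big_pred1 j). Qed.

Lemma tvar_out m k : (m < k)%N -> t_[m] k = 0.
Proof.
by move=> mk; rewrite /tvar big_pred0 // => j; have := ltn_ord j; lia.
Qed.

Lemma tvar0 m : t_[m] 0 = 0.
Proof. by rewrite /tvar big_pred0. Qed.

Lemma tvar_homog m k : t_[m] k \is 1.-homog.
Proof. by apply: rpred_sum => j _; rewrite dhomogX /= mdeg1. Qed.

Lemma tvar_comp m l k : (l <= m)%N ->
  t_[m] k \mPo [tuple t_[l] j.+1 | j < m] = t_[l] k.
Proof.
move=> lm; have [->|k0] := posnP k; first by rewrite !tvar0 linear0.
have [km|mk] := leqP k m; last by rewrite !tvar_out ?linear0 //; lia.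
have jm : (k.-1 < m)%N by lia.
have -> : k = (Ordinal jm).+1 by rewrite /= prednK.
by rewrite tvar_ord comp_mpolyXU -tnth_nth tnth_mktuple.
Qed.

(** For [m = 2n] this is the change of coordinates; for [m = 2n - 3] it
    parametrizes the subspace on which the last three coordinates vanish, as
    the variables [t_k] with [k > m] are 0. *)
Definition coords m : (n * 2).-tuple {mpoly K[m]} :=
  [tuple mxvec (\matrix_(a < n, i < 2) xform t_[m] a i) 0 k | k < n * 2].

Lemma tnth_coords m a i : tnth (coords m) (mxvec_index a i) = xform t_[m] a i.
Proof. by rewrite tnth_mktuple mxvecE mxE. Qed.

Lemma coords_homog m k : tnth (coords m) k \is 1.-homog.
Proof.
case/mxvec_indexP: k => a i; rewrite tnth_coords /xform /=.
by do !case: ifP => _; rewrite ?rpredB ?rpredD ?tvar_homog.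
Qed.

Lemma to_tcoordE (psi : spinor R (n * 2) N) s :
  to_tcoord psi s = psi s \mPo coords (2 * n).
Proof. by rewrite ffunE. Qed.

Lemma trestrict_comp (psi : spinor R (n * 2) N) l s : (l <= 2 * n)%N ->
  (psi s \mPo coords (2 * n)) \mPo [tuple t_[l] k.+1 | k < 2 * n] =
  psi s \mPo coords l.
Proof.
move=> ln; rewrite comp_mpolyA.
have -> // : [tuple tnth (coords (2 * n)) i \mPo [tuple t_[l] k.+1 | k < 2 * n]
    | i < n * 2] = coords l.
apply: eq_from_tnth => k.
rewrite tnth_mktuple; case/mxvec_indexP: k => a i; rewrite !tnth_coords.
rewrite (raddf_xform (comp_mpoly [tuple t_[l] k.+1 | k < 2 * n])).
by apply: eq_xform => k; apply: tvar_comp.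
Qed.

Lemma dder_coords m (j : 'I_m) a i :
  dder (delta_mx 0 j) (tnth (coords m) (mxvec_index a i)) =
  xform (fun k => if j.+1 == k then 1 else 0) a i.
Proof.
rewrite tnth_coords raddf_xform; apply: eq_xform => k; exact: dder_tvar.
Qed.

Hypothesis hn : (3 <= n)%N.
Local Notation p := (ix_p hn).
Local Notation q := (ix_q hn).
Local Notation s := (ix_s hn).
Local Notation l := (2 * n - 3)%N.
Local Notation basis_vec := (@basis_vec K n).
Local Notation dir_u := (@dir_u K n s).
Local Notation dir_c := (@dir_c K n s).

Lemma dir_uE a i : dir_u 0 (mxvec_index a i) =
  if a == s then if i == 0 then 1 else -1 else 0.
Proof.
rewrite !mxE !eqxx !mxvec_index_eq.
case: (a == s) => //=; last by rewrite subr0.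
by have [->|->] := ord2P i; rewrite /= ?subr0 ?sub0r.
Qed.

Lemma dir_cE a i : dir_c 0 (mxvec_index a i) = if a == s then 1 else 0.
Proof.
rewrite !mxE !eqxx !mxvec_index_eq.
case: (a == s) => //=; last by rewrite addr0.
by have [->|->] := ord2P i; rewrite /= ?addr0 ?add0r.
Qed.

Lemma basis_vecE a i b j : basis_vec a i 0 (mxvec_index b j) =
  if (b == a) && (j == i) then 1 else 0.
Proof. by rewrite !mxE !eqxx !mxvec_index_eq; case: ifP. Qed.

Variant coord_spec (a : 'I_n) (i : 'I_2) : Prop :=
| CoordC0 of a = s & i = 0
| CoordC1 of a = s & i = 1
| CoordQ of a = q & i = 0
| CoordP of a = p & i = 1
| CoordT of a != s & (a, i) != (q, 0) & (a, i) != (p, 1).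

Lemma coordP a i : coord_spec a i.
Proof.
have [as_|as_] := eqVneq a s.
  by have [i0|i1] := ord2P i; [apply: CoordC0|apply: CoordC1].
have [[aq i0]|aq] := eqVneq (a, i) (q, 0); first exact: CoordQ.
have [[ap i1]|ap] := eqVneq (a, i) (p, 1); first exact: CoordP.
exact: CoordT.
Qed.

Lemma tindex_bound (a : 'I_n) (i : 'I_2) : (0 < tindex a i < l)%N.
Proof.
rewrite /tindex; case: ifP => a1; last by case: ifP => _; lia.
by case: ifP => _; lia.
Qed.

Lemma tindex_inj a i b j :
    a != s -> (a, i) != (q, 0) -> (a, i) != (p, 1) ->
    b != s -> (b, j) != (q, 0) -> (b, j) != (p, 1) ->
  (tindex a i == tindex b j) = (b == a) && (j == i).
Proof.
move=> as_ aq ap bs bq bp; rewrite /tindex.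
have [lta ltb] := (ltn_ord a, ltn_ord b).
move: as_ aq ap bs bq bp.
rewrite !xpair_eqE -[b == a]val_eqE -!(val_eqE a) -!(val_eqE b) /=.
have e01 : (0 == 1 :> 'I_2) = false by [].
have e10 : (1 == 0 :> 'I_2) = false by [].
move: (nat_of_ord a) (nat_of_ord b) lta ltb hn => {}a {}b lta ltb hn'.
case: (ord2P i) => ->; case: (ord2P j) => ->;
  rewrite ?eqxx ?e01 ?e10 ?andbT ?andbF => as_ aq ap bs bq bp;
  case: (boolP (a < n - 3)%N) => ?; case: (boolP (b < n - 3)%N) => ?;
  case: (boolP (a.+1 == n - 2)%N) => ?; case: (boolP (b.+1 == n - 2)%N) => ?;
  by lia.
Qed.

Lemma tangent_basis a i :
    a != s -> (a, i) != (q, 0) -> (a, i) != (p, 1) ->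
  tangent (coords l) (basis_vec a i).
Proof.
move=> as_ aq ap; have /andP[t0 tl] := tindex_bound a i.
have jl : ((tindex a i).-1 < l)%N by lia.
exists (delta_mx 0 (Ordinal jl)) => k; case/mxvec_indexP: k => b j.
rewrite dder_coords basis_vecE /= prednK //.
case: (coordP b j) => [-> ->|-> ->|-> ->|-> ->|bs bq bp].
- rewrite xform_c0 !ifN ?addr0 ?mpolyC0 //; try lia.
  by rewrite eq_sym negb_and as_.
- rewrite xform_c1 !ifN ?subr0 ?mpolyC0 //; try lia.
  by rewrite eq_sym negb_and as_.
- rewrite xform_q !ifN ?mpolyC0 //; try lia.
  by rewrite -xpair_eqE eq_sym.
- rewrite xform_p !ifN ?mpolyC0 //; try lia.
  by rewrite -xpair_eqE eq_sym.
rewrite (xform_coord _ bs bq bp) tindex_inj //.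
by case: ifP => _; rewrite ?mpolyC0 ?mpolyC1.
Qed.

Lemma tangent_c : tangent (coords l) dir_c.
Proof.
have jl : (l.-1 < l)%N by lia.
exists (delta_mx 0 (Ordinal jl)) => k; case/mxvec_indexP: k => b j.
rewrite dder_coords dir_cE /= prednK; last by lia.
have qs := ix_qs hn; have ps := ix_ps hn.
case: (coordP b j) => [-> ->|-> ->|-> ->|-> ->|bs bq bp].
- rewrite xform_c0 !eqxx ifN ?addr0 ?mpolyC1 //; lia.
- rewrite xform_c1 !eqxx ifN ?subr0 ?mpolyC1 //; lia.
- rewrite xform_q !ifN ?mpolyC0 //; lia.
- rewrite xform_p !ifN ?mpolyC0 //; lia.
rewrite (xform_coord _ bs bq bp) !ifN ?mpolyC0 //.
by have := tindex_bound b j; lia.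
Qed.

Lemma dder_u (f : {mpoly K[n * 2]}) (j : 'I_(2 * n)) :
    j.+1 = (2 * n - 2)%N ->
  dder (delta_mx 0 j) (f \mPo coords (2 * n)) =
  dder dir_u f \mPo coords (2 * n).
Proof.
move=> jE; apply: dder_comp => k; case/mxvec_indexP: k => b i.
rewrite dder_coords dir_uE /= jE.
have qs := ix_qs hn; have ps := ix_ps hn.
case: (coordP b i) => [-> ->|-> ->|-> ->|-> ->|bs bq bp].
- rewrite xform_c0 !eqxx ifN ?add0r ?mpolyC1 //; lia.
- rewrite xform_c1 !eqxx ifN ?sub0r ?mpolyCN ?mpolyC1 //; lia.
- rewrite xform_q !ifN ?mpolyC0 //; lia.
- rewrite xform_p !ifN ?mpolyC0 //; lia.
rewrite (xform_coord _ bs bq bp) !ifN ?mpolyC0 //.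
by have := tindex_bound b i; lia.
Qed.

Lemma initial_data1 (psi : spinor R (n * 2) N) t :
  (initial_data psi).1 t = psi t \mPo coords l.
Proof.
by rewrite /initial_data /= ffunE to_tcoordE trestrict_comp //; lia.
Qed.

Lemma initial_data2 (psi : spinor R (n * 2) N) t :
  (initial_data psi).2 t = sder dir_u psi t \mPo coords l.
Proof.
have jl : ((2 * n - 2).-1 < 2 * n)%N by lia.
have jE : (Ordinal jl).+1 = (2 * n - 2)%N by rewrite /=; lia.
rewrite /initial_data /= ffunE -trestrict_comp; last by lia.
congr (_ \mPo _); rewrite sderE -(dder_u _ jE) dder_delta ffunE.
rewrite (big_pred1 (Ordinal jl)) ?to_tcoordE // => j.
by rewrite /= -val_eqE /=; lia.
Qed.

End InitialData.

Lemma scomp_is_linear (K : numFieldType) (N m l : nat)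
    (h : m.-tuple {mpoly K[l]}) :
  linear (fun psi : {ffun 'I_N -> {mpoly K[m]}} =>
            [ffun t => psi t \mPo h] : {ffun 'I_N -> {mpoly K[l]}}).
Proof.
by move=> c f g; apply/ffunP => t; rewrite !ffunE comp_mpolyD comp_mpolyZ.
Qed.

Section InitialDataLinear.
Variables (R : realType) (N : nat).

Lemma trestrict_is_linear m l : linear (@trestrict R N m l).
Proof. exact: scomp_is_linear. Qed.

Lemma to_tcoord_is_linear n : linear (@to_tcoord R N n).
Proof. exact: scomp_is_linear. Qed.

Lemma dt_is_linear m k : linear (@dt R N m k).
Proof.
move=> c f g; apply/ffunP => t; rewrite !ffunE scaler_sumr -big_split.
by apply: eq_bigr => j _; rewrite /= mderivD mderivZ.
Qed.

Lemma initial_data_is_linear n : linear (@initial_data R N n).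
Proof.
move=> c f g; rewrite /initial_data to_tcoord_is_linear dt_is_linear.
by rewrite !trestrict_is_linear.
Qed.
HB.instance Definition _ n :=
  GRing.isLinear.Build R[i] (spinor R (n * 2) N)
    (spinor R (2 * n - 3) N * spinor R (2 * n - 3) N)%type _
    (@initial_data R N n) (@initial_data_is_linear n).

End InitialDataLinear.

(** * The extension of the data and the theorem *)

Section Extension.
Variables (R : realType) (N n : nat).
Local Notation K := (R[i]).
Hypothesis hn : (3 <= n)%N.
Local Notation p := (ix_p hn).
Local Notation q := (ix_q hn).
Local Notation s := (ix_s hn).
Local Notation l := (2 * n - 3)%N.
Local Notation basis_vec := (@basis_vec K n).
Local Notation coordX := (@coordX K n).
Local Notation xu := (@xu K n s).
Local Notation dir_u := (@dir_u K n s).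
Local Notation coords := (coords R n).

Lemma coordX_coords m a i : coordX a i \mPo coords m = xform (@tvar R m) a i.
Proof. by rewrite comp_mpolyXU -tnth_nth tnth_coords. Qed.

Lemma xu_coords : xu \mPo coords l = 0.
Proof.
rewrite comp_mpolyZ comp_mpolyB !coordX_coords xform_c0 xform_c1.
rewrite [@tvar R l (2 * n - 2)]tvar_out; last by lia.
by rewrite addr0 subr0 subrr scaler0.
Qed.

Lemma Xq_coords : coordX q 0 \mPo coords l = 0.
Proof. by rewrite coordX_coords xform_q tvar_out //; lia. Qed.

Lemma Xp_coords : coordX p 1 \mPo coords l = 0.
Proof. by rewrite coordX_coords xform_p tvar_out //; lia. Qed.

Lemma tindex_surj k : (0 < k < l)%N ->
  exists a i, [/\ a != s, (a, i) != (q, 0), (a, i) != (p, 1) & tindex a i = k].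
Proof.
move=> /andP[k0 kl].
have e01 : (0 == 1 :> 'I_2) = false by [].
have e10 : (1 == 0 :> 'I_2) = false by [].
have [kE|kE] := eqVneq k (2 * n - 4)%N.
  exists q, 1; rewrite !xpair_eqE e10 andbF eqxx andbT.
  by split; rewrite -?val_eqE /= ?/tindex /= ?ifN //; lia.
have an : (k.-1./2 < n)%N by lia.
have kD : k = ((k.-1./2).*2 + ~~ odd k).+1.
  by case: (k) k0 => //= m _; rewrite negbK addnC odd_double_half.
move: (k.-1./2) an kD => a an kD.
have [ko|ke] := boolP (odd k); rewrite ?ko ?(negPf ke) /= in kD.
  exists (Ordinal an), 0; rewrite !xpair_eqE e01 andbF eqxx andbT.
  split; rewrite -?val_eqE //= ?/tindex /=; [lia|lia|].
  by case: (boolP (a < n - 3)%N) => ?; case: (boolP (a.+1 == n - 2)%N) => ?;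
  lia.
exists (Ordinal an), 1; rewrite !xpair_eqE e10 andbF eqxx andbT.
split; rewrite -?val_eqE //= ?/tindex /=; [lia|lia|].
by case: (boolP (a < n - 3)%N) => ?; case: (boolP (a.+1 == n - 2)%N) => ?;
  lia.
Qed.

(** A linear form equal to [t_(k+1)] on the subspace and constant in the
    transversal directions: one of the [x_(a,i)], or [(x_(s,1) + x_(s,2)) / 2]
    for [t_(2n-3)]. *)
Lemma coords_section (k : 'I_l) : exists x : {mpoly K[n * 2]},
  [/\ x \is 1.-homog, x \mPo coords l = 'X_k &
      forall y, y \in [:: dir_u; basis_vec q 0; basis_vec p 1] -> dder y x = 0].
Proof.
rewrite -tvar_ord; have [kE|kE] := eqVneq k.+1 l.
  exists (2^-1 *: (coordX s 0 + coordX s 1)); split.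
  - by apply: rpredZ; apply: rpredD; apply: coordX_homog.
  - rewrite comp_mpolyZ comp_mpolyD !coordX_coords xform_c0 xform_c1 addrACA.
    by rewrite subrr addr0 scalerDr -scalerDl half_add_half scale1r kE.
  have qs := negPf (ix_qs hn); have ps := negPf (ix_ps hn).
  move=> y; rewrite !inE linearZ linearD /= !dderXU => /or3P[] /eqP ->.
  - by rewrite !dir_uE !eqxx /= -mpolyCD subrr mpolyC0 scaler0.
  - by rewrite !basis_vecE ![s == q]eq_sym qs /= mpolyC0 addr0 scaler0.
  by rewrite !basis_vecE ![s == p]eq_sym ps /= mpolyC0 addr0 scaler0.
have [|a [i [as_ aq ap ai]]] := @tindex_surj k.+1.
  by have := ltn_ord k; lia.
exists (coordX a i); split; first exact: coordX_homog.
  by rewrite coordX_coords (xform_coord _ as_ aq ap) ai.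
move=> y; rewrite !inE dderXU => /or3P[] /eqP ->.
- by rewrite dir_uE (negPf as_) mpolyC0.
- by rewrite basis_vecE -xpair_eqE (negPf aq) mpolyC0.
by rewrite basis_vecE -xpair_eqE (negPf ap) mpolyC0.
Qed.

Lemma extension r (f : spinor R l N) : homogeneous r f ->
  exists F : spinor R (n * 2) N,
    [/\ sdeg r.+1 F, forall t, F t \mPo coords l = f t &
        forall y, y \in [:: dir_u; basis_vec q 0; basis_vec p 1] ->
          sder y F = 0].
Proof.
move=> fr; have /fin_all_exists [tau tauP] := coords_section.
pose T := [tuple tau k | k < l]; exists [ffun t => f t \mPo T]; split.
- apply/sdegP => t; rewrite ffunE; apply: comp_homog => // k.
  by rewrite tnth_mktuple; case: (tauP k).
- move=> t; rewrite ffunE; apply: comp_section => k.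
  by rewrite tnth_mktuple; case: (tauP k).
move=> y yin; apply/ffunP => t; rewrite sderE !ffunE (dder_comp (v := 0)).
  by rewrite -(scale0r 0) dderZv scale0r linear0.
by move=> k; rewrite tnth_mktuple mxE mpolyC0; case: (tauP k) => _ _; apply.
Qed.

End Extension.

Lemma diracE (R : realType) (N n : nat) (eps : 'I_n -> 'M[R[i]]_N) i
    (psi : spinor R (n * 2) N) :
  dirac eps i psi = \sum_a mxact (eps a) (sder (basis_vec _ a i) psi).
Proof.
apply/ffunP => t; rewrite ffunE sum_ffunE; apply: eq_bigr => a _.
by rewrite mxactE; apply: eq_bigr => t' _; rewrite sderE dder_delta.
Qed.

Lemma monogenic_evolves (R : realType) (N n : nat) (eps : 'I_n -> 'M[R[i]]_N)
    (heps : clifford_relations eps) p q (psi : spinor R (n * 2) N) :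
  monogenic eps psi <-> evolves eps p q psi.
Proof.
split=> [h|[hq hp] i].
  by split; apply/(sum_dirac_eq0 heps); rewrite -diracE h.
rewrite diracE; case: (ord2P i) => ->.
  by apply/(sum_dirac_eq0 heps); exact: hq.
by apply/(sum_dirac_eq0 heps); exact: hp.
Qed.

Theorem theorem2 (R : realType) (n r N : nat) (eps : 'I_n -> 'M[R[i]]_N)
    (hn : (3 <= n)%N) (hr : (2 <= r)%N) (heps : spinor_module eps) :
  exists Phi : {linear spinor R (n * 2) N ->
                       (spinor R (2 * n - 3) N * spinor R (2 * n - 3) N)%type},
    [/\ forall psi, Phi psi = initial_data psi,
        forall psi, monogenic eps psi -> homogeneous r psi ->
          homogeneous r (Phi psi).1 /\ homogeneous (r - 1) (Phi psi).2 &
        forall f g, homogeneous r f -> homogeneous (r - 1) g ->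
          exists! psi, [/\ monogenic eps psi, homogeneous r psi &
                           Phi psi = (f, g)]].
Proof.
have [cliff _] := heps.
have [pq [ps qs]] := (ix_pq hn, (ix_ps hn, ix_qs hn)).
have r1 : r = (r - 1).+1 by lia.
exists (@initial_data R N n); split=> // [psi _ hpsi|f g hf hg].
  split=> t.
    by rewrite (initial_data1 hn); apply: comp_homog => //; apply: coords_homog.
  rewrite (initial_data2 hn); apply: comp_homog; first exact: coords_homog.
  apply/hdegP; move: t; rewrite -r1; apply: (@sdeg_sder _ _ _ _ r.+1).
  exact/sdegP.
have [F [dF Ff Fk]] := extension hn hf.
have [G [dG Gg Gk]] := extension hn hg; rewrite -r1 in dG.
have [|psi [mpsi dpsi psih]] := cauchy_solution cliff pq ps qs _ dF dG.
  by move=> x xin; split; [apply: Fk|apply: Gk].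
exists psi; split=> [|phi [mphi dphi Dphi]].
  split; [exact/(monogenic_evolves cliff (ix_p hn) (ix_q hn))|exact/sdegP|].
  have psihh t := psih _ _ t (xu_coords R hn) (Xq_coords R hn) (Xp_coords R hn).
  rewrite [LHS]surjective_pairing; congr pair; apply/ffunP => t.
    exact: etrans (initial_data1 hn psi t) (etrans (psihh t).1 (Ff t)).
  exact: etrans (initial_data2 hn psi t) (etrans (psihh t).2 (Gg t)).
have psihh t := psih _ _ t (xu_coords R hn) (Xq_coords R hn) (Xp_coords R hn).
have phih1 t : phi t \mPo coords R n (2 * n - 3) = f t.
  by rewrite -(initial_data1 hn) [initial_data phi]Dphi.
have phih2 t :
    sder (dir_u R[i] (ix_s hn)) phi t \mPo coords R n (2 * n - 3) = g t.
  by rewrite -(initial_data2 hn) [initial_data phi]Dphi.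
have [mphiq mphip] : evolves eps (ix_p hn) (ix_q hn) phi.
  exact/(monogenic_evolves cliff (ix_p hn) (ix_q hn)).
have [mpsiq mpsip] := mpsi.
apply/eqP; rewrite -subr_eq0; apply/eqP.
apply: (@cauchy_unique _ _ _ _ cliff (ix_p hn) (ix_q hn) (ix_s hn) pq ps qs _
  (coords R n (2 * n - 3)) _ _ r.+1).
- by move=> a i as_ aq ap; apply: tangent_basis.
- exact: tangent_c.
- by apply: sdegB; [|exact/sdegP].
- by split; rewrite !raddfB /= ?mphiq ?mpsiq ?mphip ?mpsip.
- move=> t; rewrite !ffunE comp_mpolyB.
  by apply/eqP; rewrite subr_eq0 phih1 (psihh t).1 Ff.
move=> t; rewrite raddfB !ffunE comp_mpolyB.
by apply/eqP; rewrite subr_eq0 phih2 (psihh t).2 Gg.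
Qed.
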